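(* Suppose the random Hermitian coupling operator $A_a$ satisfies $\mathbb E\big[(A_a)_{i,j}\overline{(A_a)_{l,k}}\big]=\xi^2\delta_{i,l}\delta_{j,k}$ for all $i,j,k,l\in\{1,\dots,N\}$, where $\xi=\Theta(N^{-1/2})$ is a positive constant. Let $\rho_t$ be a solution of the Lindblad equation $\frac{d}{dt}\rho_t=\mathbb E_a[\mathcal L_{K_a}(\rho_t)]$ with initial condition a quantum state. Then: (i) The diagonal entries $p_i(t)=\mathbb E\langle\psi_i|\rho_t|\psi_i\rangle$ satisfy the Pauli master equation $$\frac{dp_i}{dt}=\xi^2\sum_{k\ne i}\big(\gamma(\lambda_i-\lambda_k)p_k-\gamma(\lambda_k-\lambda_i)p_i\big),\qquad 1\le i\le N.$$ (ii) For $i\ne j$, the off-diagonal entries $Q_{ij}(t)=\mathbb E\langle\psi_i|\rho_t|\psi_j\rangle$ satisfy $$\frac{dQ_{ij}}{dt}=-\frac{\xi^2}{2}\sum_{k=1}^N\big(\gamma(\lambda_k-\lambda_i)+\gamma(\lambda_k-\lambda_j)\big)Q_{ij}.$$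
   Context: $\mathcal H$ is a Hilbert space of dimension $N=2^n$ and $\mathcal B(\mathcal H)$ the space of operators on it; a quantum state is a positive semidefinite operator of trace one. $H\in\mathcal B(\mathcal H)$ is a Hermitian Hamiltonian with eigenvalues $\lambda_1,\dots,\lambda_N$ (with multiplicity) and a corresponding orthonormal eigenbasis $|\psi_1\rangle,\dots,|\psi_N\rangle$; $B_H=\operatorname{spec}(H)-\operatorname{spec}(H)$. $\beta>0$, and $\gamma$ is a non-negative function with $\gamma(\omega)=e^{-\beta\omega}\gamma(-\omega)$. $\{A_a\}$ is an ensemble of random Hermitian operators in $\mathcal B(\mathcal H)$, $\mathbb E=\mathbb E_a$ is expectation over the ensemble, and $(A_a)_{i,j}=\langle\psi_i|A_a|\psi_j\rangle$. $f$ is an (integrable) weight function whose Fourier transform $\hat f(\omega)=\int_{-\infty}^\infty f(s)e^{i\omega s}\,ds$ satisfies $\hat f(\omega)=\sqrt{\gamma(\omega)}$ for all $\omega\in B_H$, and $$K_a=\int_{-\infty}^\infty f(s)e^{iHs}A_ae^{-iHs}\,ds=\sum_{i,j=1}^N\hat f(\lambda_i-\lambda_j)|\psi_i\rangle\langle\psi_i|A_a|\psi_j\rangle\langle\psi_j|,$$ $\mathcal L_{K_a}(\rho)=K_a\rho K_a^\dagger-\tfrac12\{K_a^\dagger K_a,\rho\}$. (The solution $\rho_t$ of the averaged equation is deterministic, so the expectation in the definitions of $p_i$ and $Q_{ij}$ is redundant.) *)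

(* Defs.v *)
(* The N-dimensional Hilbert space is C^N (column vectors over R[i], with
   R : realType) with its standard inner product. *)
From HB Require Import structures.
From mathcomp Require Export all_boot all_order all_algebra.
From mathcomp Require Export complex.
From mathcomp Require Export all_classical all_reals all_analysis.
Export Order.TTheory GRing.Theory Num.Theory.
Export numFieldNormedType.Exports.

Set Implicit Arguments.
Unset Strict Implicit.
Unset Printing Implicit Defensive.

Local Open Scope classical_set_scope.
Local Open Scope ring_scope.
Local Open Scope complex_scope.
Local Open Scope sesquilinear_scope.

(* Complex-valued limits, integrals, expectations and derivatives are taken on
   real and imaginary parts; R[i] is identified with R x R. *)
Section ComplexAnalysis.
Context {R : realType}.

Definition cReIm_lim (u : nat -> R[i]) : R[i] :=
  lim ((fun m => complex.Re (u m)) @ \oo)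
    +i* lim ((fun m => complex.Im (u m)) @ \oo).

Definition expi (x : R) : R[i] := cos x +i* sin x.

Definition cLintegrable (f : R -> R[i]) : Prop :=
  (@lebesgue_measure R).-integrable setT (fun s => (complex.Re (f s))%:E) /\
  (@lebesgue_measure R).-integrable setT (fun s => (complex.Im (f s))%:E).

Definition cLintegral (f : R -> R[i]) : R[i] :=
  (\int[@lebesgue_measure R]_s complex.Re (f s))
    +i* (\int[@lebesgue_measure R]_s complex.Im (f s)).

(* \hat f(w) = \int f(s) e^{iws} ds, with a plus sign and no prefactor *)
Definition fourier (f : R -> R[i]) (w : R) : R[i] :=
  cLintegral (fun s => f s * expi (w * s)).

(* 'E_P is extended-real valued and [fine] sends infinite values to 0.  In
   particular a nonzero value of cexpectation P (fun a => X a * conj (X a)),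
   with X measurable, forces X to be square integrable. *)
Definition cexpectation d (T : measurableType d) (P : probability T R)
    (X : T -> R[i]) : R[i] :=
  fine ('E_P[fun a => complex.Re (X a)])
    +i* fine ('E_P[fun a => complex.Im (X a)]).

(* dz/dt = l at the point t >= 0, for z considered on [0, +oo[ : the two-sided
   derivative when t > 0, the right derivative when t = 0. *)
Definition has_derivative_at (z : R -> R[i]) (t : R) (l : R[i]) : Prop :=
  ((fun h => h^-1 * (complex.Re (z (t + h)) - complex.Re (z t)))
     @ within [set h | 0 <= t + h] 0^' --> complex.Re l) /\
  ((fun h => h^-1 * (complex.Im (z (t + h)) - complex.Im (z t)))
     @ within [set h | 0 <= t + h] 0^' --> complex.Im l).

End ComplexAnalysis.

Section Operators.
Context {R : realType} {N : nat}.
Implicit Types (H A K rho M : 'M[R[i]]_N) (u v : 'cV[R[i]]_N).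

(* <u|M|v>, conjugate-linear in u *)
Definition braket u M v : R[i] := (u^t* *m M *m v) 0 0.

Definition orthonormal_basis (psi : 'I_N -> 'cV[R[i]]_N) : Prop :=
  forall i j, ((psi i)^t* *m psi j) 0 0 = (i == j)%:R.

(* psi is an orthonormal eigenbasis of H, with eigenvalues lam listed with
   multiplicity *)
Definition orthonormal_eigenbasis H (lam : 'I_N -> R)
    (psi : 'I_N -> 'cV[R[i]]_N) : Prop :=
  orthonormal_basis psi /\ forall i, H *m psi i = (lam i)%:C *: psi i.

Definition quantum_state rho : Prop :=
  [/\ rho \is hermsymmx, forall v, 0 <= braket v rho v & \tr rho = 1].

(* Real spectrum; this is the whole spectrum when H is Hermitian. *)
Definition spec H : set R := [set x | eigenvalue H x%:C].

Definition bohr_frequencies H : set R :=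
  [set x - y | x in spec H & y in spec H].

Definition expmx M : 'M[R[i]]_N :=
  \matrix_(i, j)
    cReIm_lim (fun m => (\sum_(k < m) (k`!%:R)^-1 *: M ^+ k) i j).

(* K = \int f(s) e^{iHs} A e^{-iHs} ds, integrated entrywise *)
Definition coupling (f : R -> R[i]) H A : 'M[R[i]]_N :=
  \matrix_(i, j) cLintegral (fun s =>
    (f s *: (expmx ((s *i) *: H) *m A *m expmx (- (s *i) *: H))) i j).

Definition lindblad K rho : 'M[R[i]]_N :=
  K *m rho *m K^t* - 2^-1 *: (K^t* *m K *m rho + rho *m (K^t* *m K)).

Definition mx_expectation d (T : measurableType d) (P : probability T R)
    (X : T -> 'M[R[i]]_N) : 'M[R[i]]_N :=
  \matrix_(i, j) cexpectation P (fun a => X a i j).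

Definition random_hermitian d (T : measurableType d) (A : T -> 'M[R[i]]_N) :
    Prop :=
  (forall i j, measurable_fun setT (fun a => complex.Re (A a i j)) /\
               measurable_fun setT (fun a => complex.Im (A a i j))) /\
  (forall a, A a \is hermsymmx).

Definition averaged_lindblad_solution d (T : measurableType d)
    (P : probability T R) (K : T -> 'M[R[i]]_N) (rho : R -> 'M[R[i]]_N) :
    Prop :=
  quantum_state (rho 0) /\
  forall t, 0 <= t -> forall i j,
    has_derivative_at (fun s => rho s i j) t
      (mx_expectation P (fun a => lindblad (K a) (rho t)) i j).

End Operators.

(* Main.v *)
(* In the eigenbasis of H the coupling operator has entries
   K_kl = sqrt (gamma (lam_k - lam_l)) A_kl, so the averaged generator only
   involves the second moments E[A_ij conj A_lk].  By the covariance assumption,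
   E[K rho K^*] is diagonal with entries xi^2 sum_k gamma (lam_i - lam_k) rho_kk
   and E[K^* K] is diagonal with entries xi^2 sum_k gamma (lam_k - lam_i).  Since
   xi > 0, the same assumption forces the entries of A to be square integrable,
   which justifies exchanging E with finite sums. *)
Require Import Defs.
From mathcomp Require Import measurable_realfun ring lra.

Set Implicit Arguments.
Unset Strict Implicit.
Unset Printing Implicit Defensive.

Local Open Scope classical_set_scope.
Local Open Scope ring_scope.
Local Open Scope complex_scope.
Local Open Scope sesquilinear_scope.

(** * Real and imaginary parts of sums and products *)

Lemma ReD (R : realType) (x y : R[i]) :
  complex.Re (x + y) = complex.Re x + complex.Re y.
Proof. by case: x y => [? ?] []. Qed.

Lemma ImD (R : realType) (x y : R[i]) :
  complex.Im (x + y) = complex.Im x + complex.Im y.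
Proof. by case: x y => [? ?] []. Qed.

(** The form [+ -] instead of a difference presents the real part as a linear combination of [Re y]
    and [Im y] with coefficients [Re x] and [- Im x], as the linearity lemmas expect. *)
Lemma ReM (R : realType) (x y : R[i]) : complex.Re (x * y) =
  complex.Re x * complex.Re y + - complex.Im x * complex.Im y.
Proof. by case: x y => [? ?] [? ?] /=; rewrite mulNr. Qed.

Lemma ImM (R : realType) (x y : R[i]) : complex.Im (x * y) =
  complex.Re x * complex.Im y + complex.Im x * complex.Re y.
Proof. by case: x y => [? ?] []. Qed.

(** * Integration of complex-valued functions over an arbitrary measure *)

Section ComplexIntegral.
Context d (T : measurableType d) (R : realType).
Variable mu : {measure set T -> \bar R}.
Implicit Types (f g : T -> R[i]) (c : R[i]).

(** A common form for the Lebesgue integrals defining the coupling operator and for expectations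
    over the ensemble, so that linearity is proved once. *)
Definition cintegral f : R[i] :=
  (\int[mu]_x complex.Re (f x)) +i* (\int[mu]_x complex.Im (f x)).

Definition cintegrable f : Prop :=
  mu.-integrable setT (fun x => (complex.Re (f x))%:E) /\
  mu.-integrable setT (fun x => (complex.Im (f x))%:E).

Lemma integrable_linear (a b : R) (u v : T -> R) :
  mu.-integrable setT (EFin \o u) -> mu.-integrable setT (EFin \o v) ->
  mu.-integrable setT (EFin \o (fun x => a * u x + b * v x)).
Proof.
move=> hu hv.
rewrite (_ : _ \o _ = (fun x => a%:E * (EFin \o u) x) \+
                      (fun x => b%:E * (EFin \o v) x))%E; last exact/funext.
by apply: integrableD => //; apply: integrableZl.
Qed.

Lemma Rintegral_linear (a b : R) (u v : T -> R) :
  mu.-integrable setT (EFin \o u) -> mu.-integrable setT (EFin \o v) ->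
  \int[mu]_x (a * u x + b * v x) = a * \int[mu]_x u x + b * \int[mu]_x v x.
Proof.
move=> hu hv; rewrite RintegralD// ?RintegralZl//.
  (* Integrability of each summand is the case of a linear combination whose other coefficient is
     0. *)
  have := integrable_linear a 0 hu hu.
  by congr (_.-integrable _ _); apply/funext => x /=; rewrite mul0r addr0.
have := integrable_linear b 0 hv hv.
by congr (_.-integrable _ _); apply/funext => x /=; rewrite mul0r addr0.
Qed.

Lemma cintegrableZ c f : cintegrable f -> cintegrable (fun x => c * f x).
Proof.
move=> [hr hi]; split.
  have := integrable_linear (complex.Re c) (- complex.Im c) hr hi.
  by congr (_.-integrable _ _); apply/funext => x /=; rewrite ReM.
have := integrable_linear (complex.Re c) (complex.Im c) hi hr.
by congr (_.-integrable _ _); apply/funext => x /=; rewrite ImM.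
Qed.

Lemma cintegrableD f g :
  cintegrable f -> cintegrable g -> cintegrable (fun x => f x + g x).
Proof.
move=> [fr fi] [gr gi]; split.
  have := integrable_linear 1 1 fr gr.
  by congr (_.-integrable _ _); apply/funext => x /=; rewrite ReD !mul1r.
have := integrable_linear 1 1 fi gi.
by congr (_.-integrable _ _); apply/funext => x /=; rewrite ImD !mul1r.
Qed.

Lemma eq_cintegral f g : f =1 g -> cintegral f = cintegral g.
Proof. by move=> /funext ->. Qed.

Lemma cintegral0 : cintegral (fun=> 0) = 0.
Proof. by rewrite /cintegral /= /Rintegral integral0. Qed.

Lemma cintegrable0 : cintegrable (fun=> 0).
Proof. by split; exact: integrable0. Qed.

Lemma cintegralZ c f :
  cintegrable f -> cintegral (fun x => c * f x) = c * cintegral f.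
Proof.
move=> [hr hi]; rewrite /cintegral.
under eq_Rintegral do rewrite ReM.
under [X in _ +i* X]eq_Rintegral do rewrite ImM.
by rewrite !Rintegral_linear//; case: c => a b /=; congr (_ +i* _); rewrite mulNr.
Qed.

Lemma cintegralD f g : cintegrable f -> cintegrable g ->
  cintegral (fun x => f x + g x) = cintegral f + cintegral g.
Proof.
move=> [fr fi] [gr gi]; rewrite /cintegral.
under eq_Rintegral do rewrite ReD.
under [X in _ +i* X]eq_Rintegral do rewrite ImD.
by rewrite !RintegralD.
Qed.

Lemma cintegrable_sum (I : Type) (r : seq I) (p : pred I) (F : I -> T -> R[i]) :
  (forall i, p i -> cintegrable (F i)) ->
  cintegrable (fun x => \sum_(i <- r | p i) F i x).
Proof.
move=> hF; elim: r => [|i r IHr].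
  rewrite [X in cintegrable X](_ : _ = fun=> 0); first exact: cintegrable0.
  by apply/funext => x; rewrite big_nil.
rewrite [X in cintegrable X](_ : _ = fun x =>
    if p i then F i x + \sum_(j <- r | p j) F j x
    else \sum_(j <- r | p j) F j x).
  by case: (boolP (p i)) => // pi; apply: cintegrableD => //; exact: hF.
by apply/funext => x; rewrite big_cons.
Qed.

Lemma cintegral_sum (I : Type) (r : seq I) (p : pred I) (F : I -> T -> R[i]) :
  (forall i, p i -> cintegrable (F i)) ->
  cintegral (fun x => \sum_(i <- r | p i) F i x) =
  \sum_(i <- r | p i) cintegral (F i).
Proof.
move=> hF; elim: r => [|i r IHr].
  by under eq_cintegral do rewrite big_nil; rewrite big_nil cintegral0.
under eq_cintegral do rewrite big_cons; rewrite big_cons.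
case: (boolP (p i)) => // pi; rewrite cintegralD ?IHr//; first exact: hF.
exact: cintegrable_sum.
Qed.

End ComplexIntegral.

Lemma cexpectationE (R : realType) d (T : measurableType d)
    (P : probability T R) (X : T -> R[i]) :
  cexpectation P X = cintegral P X.
Proof. by rewrite /cexpectation unlock. Qed.

(** * Componentwise limits and derivatives of complex-valued functions *)

Section ComplexConvergence.
Context (R : realType) (T : Type) (F : set_system T) {FF : Filter F}.
Implicit Types (u v : T -> R[i]) (l m c : R[i]).

Definition ccvg u l : Prop :=
  (complex.Re (u x) @[x --> F] --> complex.Re l) /\
  (complex.Im (u x) @[x --> F] --> complex.Im l).

Lemma ccvg_cst c : ccvg (fun=> c) c.
Proof. by split; exact: cvg_cst. Qed.

Lemma ccvgD u v l m :
  ccvg u l -> ccvg v m -> ccvg (fun x => u x + v x) (l + m).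
Proof.
move=> [ur ui] [vr vi]; split; rewrite ?ReD ?ImD.
  under eq_fun do rewrite ReD; exact: cvgD.
under eq_fun do rewrite ImD; exact: cvgD.
Qed.

Lemma ccvgZ c u l : ccvg u l -> ccvg (fun x => c * u x) (c * l).
Proof.
move=> [ur ui]; split; rewrite ?ReM ?ImM.
  by under eq_fun do rewrite ReM; apply: cvgD; apply: cvgM => //; exact: cvg_cst.
by under eq_fun do rewrite ImM; apply: cvgD; apply: cvgM => //; exact: cvg_cst.
Qed.

Lemma ccvg_sum (I : Type) (r : seq I) (u : I -> T -> R[i]) (l : I -> R[i]) :
  (forall i, ccvg (u i) (l i)) ->
  ccvg (fun x => \sum_(i <- r) u i x) (\sum_(i <- r) l i).
Proof.
move=> hu; elim: r => [|i r IHr].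
  rewrite big_nil [X in ccvg X](_ : _ = fun=> 0); first exact: ccvg_cst.
  by apply/funext => x; rewrite big_nil.
rewrite big_cons [X in ccvg X](_ : _ = fun x =>
    u i x + \sum_(j <- r) u j x); first exact: ccvgD.
by apply/funext => x; rewrite big_cons.
Qed.

End ComplexConvergence.

Lemma ccvg_cReIm_lim (R : realType) (u : nat -> R[i]) l :
  ccvg \oo u l -> cReIm_lim u = l.
Proof.
move=> [ur ui]; rewrite /cReIm_lim !(cvg_lim _ ur, cvg_lim _ ui)//.
by case: l ur ui.
Qed.

(** Since [h^-1] is real, multiplying by it acts separately on real and imaginary parts. The
    derivative thus becomes the limit of one complex difference quotient, and the limit rules above
    apply. *)
Lemma has_derivative_atE (R : realType) (z : R -> R[i]) t l :
  has_derivative_at z t l <->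
  ccvg (within [set h | 0 <= t + h] 0^')
    (fun h => (h^-1)%:C * (z (t + h) - z t)) l.
Proof.
rewrite /has_derivative_at /ccvg.
have -> : (fun h => complex.Re ((h^-1)%:C * (z (t + h) - z t))) =
    (fun h => h^-1 * (complex.Re (z (t + h)) - complex.Re (z t))).
  by apply/funext => h; case: (z _) (z _) => [? ?] [? ?] /=; ring.
have -> // : (fun h => complex.Im ((h^-1)%:C * (z (t + h) - z t))) =
    (fun h => h^-1 * (complex.Im (z (t + h)) - complex.Im (z t))).
by apply/funext => h; case: (z _) (z _) => [? ?] [? ?] /=; ring.
Qed.

Lemma has_derivative_at_linear (R : realType) (I : finType)
    (c : I -> R[i]) (z : I -> R -> R[i]) t (l : I -> R[i]) :
  (forall i, has_derivative_at (z i) t (l i)) ->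
  has_derivative_at (fun s => \sum_i c i * z i s) t (\sum_i c i * l i).
Proof.
move=> hz; apply/has_derivative_atE.
rewrite [X in ccvg _ X](_ : _ = fun h =>
    \sum_i c i * ((h^-1)%:C * (z i (t + h) - z i t))).
  apply: ccvg_sum => i; apply: ccvgZ; exact/has_derivative_atE.
by apply/funext => h; rewrite -sumrB mulr_sumr; apply: eq_bigr => i _; ring.
Qed.

(** * The imaginary exponential as the sum of its power series *)

Section Expi.
Context (R : realType).

Lemma expiD (x y : R) : expi (x + y) = expi x * expi y.
Proof.
rewrite /expi cosD sinD; apply/eqP; rewrite eq_complex /=.
by apply/andP; split; apply/eqP; ring.
Qed.

(** Even powers of the imaginary unit are real and odd ones imaginary, both with sign given by the
    rounded-down half [k./2]. *)
Lemma exprcI (x : R) k : (x *i) ^+ k =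
  (if odd k then 0 +i* ((-1) ^+ k./2 * x ^+ k) else ((-1) ^+ k./2 * x ^+ k)%:C).
Proof.
elim: k => [|k IHk]; first by rewrite !expr0 mulr1.
rewrite exprS IHk /= uphalf_half; case: (odd k) => /=; rewrite ?add0n ?add1n;
  apply/eqP; rewrite eq_complex /= !exprS; apply/andP; split; apply/eqP; ring.
Qed.

(** The real and imaginary parts of the partial sums are the partial sums of the cosine and sine
    series. *)
Lemma ccvg_expi (x : R) :
  ccvg \oo (fun m => \sum_(k < m) (k`!%:R)^-1 * (x *i) ^+ k) (expi x).
Proof.
have E k : (k`!%:R)^-1 * (x *i) ^+ k = cos_coeff x k +i* sin_coeff x k.
  have -> : (k`!%:R : R[i])^-1 = ((k`!%:R)^-1)%:C by rewrite fmorphV rmorph_nat.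
  rewrite exprcI /cos_coeff /sin_coeff /= -!exprnP; apply/eqP.
  case: ifPn => ok; rewrite eq_complex /=; apply/andP; split; apply/eqP.
  - by ring.
  (* The sine coefficient takes its sign from [k.-1./2]; for odd [k] this is the same half as
     [k./2]. *)
  - have -> : k.-1./2 = k./2.
      by case: k ok => //= k; rewrite uphalf_half => /negbTE ->.
    by ring.
  - by ring.
  - by ring.
have S m : \sum_(k < m) (k`!%:R)^-1 * (x *i) ^+ k =
    series (cos_coeff x) m +i* series (sin_coeff x) m.
  elim: m => [|m IHm]; first by rewrite /series /= big_ord0 !big_geq.
  by rewrite big_ord_recr IHm E /series /= !big_nat_recr.
split; under eq_fun do rewrite S /=.
  (* Unlocked, [cos] is the limit of this very series, so convergence of the series is convergence
     to [cos x]; likewise for [sin]. *)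
  by rewrite /= unlock; exact: is_cvg_series_cos_coeff.
by rewrite /= unlock; exact: is_cvg_series_sin_coeff.
Qed.

End Expi.

(** * Entries of matrix products and conjugation by a unitary matrix *)

Lemma mulmx3E (R : pzRingType) m n p q (B : 'M[R]_(m, n)) (M : 'M[R]_(n, p))
    (C : 'M[R]_(p, q)) i j :
  (B *m M *m C) i j = \sum_(x : 'I_n * 'I_p) B i x.1 * M x.1 x.2 * C x.2 j.
Proof.
(* The double sum is merged into one over pairs, so that the entry is a single finite linear
   combination of the entries of [M], to which sum rules for integrals and derivatives apply
   directly. *)
rewrite mxE -(pair_bigA _ (fun k l => B i k * M k l * C l j)) exchange_big.
by apply: eq_bigr => l _; rewrite mxE mulr_suml.
Qed.

Lemma mulmx_diag3E (R : comPzRingType) m n p (B : 'M[R]_(m, n)) (D : 'rV[R]_n)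
    (C : 'M[R]_(n, p)) i j :
  (B *m diag_mx D *m C) i j = \sum_k B i k * C k j * D 0 k.
Proof.
by rewrite mul_mx_diag mxE; apply: eq_bigr => k _; rewrite mxE mulrAC.
Qed.

Section Unitary.
Context (R : realType) (N : nat).
Variable U : 'M[R[i]]_N.
Hypothesis UU : U^t* *m U = 1%:M.
Implicit Types (A K M rho : 'M[R[i]]_N).

Let UU' : U *m U^t* = 1%:M. Proof. exact: mulmx1C. Qed.

Lemma trmxCM (K M : 'M[R[i]]_N) : (K *m M)^t* = M^t* *m K^t*.
Proof. by rewrite trmx_mul map_mxM. Qed.

Lemma exprmx_conj M k : (U *m M *m U^t*) ^+ k = U *m M ^+ k *m U^t*.
Proof.
elim: k => [|k IHk]; first by rewrite !expr0 mulmx1.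
rewrite !exprS IHk -!mulmxE !mulmxA; congr (_ *m _ *m _).
by rewrite -mulmxA UU mulmx1.
Qed.

Lemma exprmx_diag (D : 'rV[R[i]]_N) k :
  (diag_mx D) ^+ k = diag_mx (\row_j D 0 j ^+ k).
Proof.
elim: k => [|k IHk].
  by apply/matrixP => i j; rewrite !mxE expr0 [in RHS]mulrb; case: eqP.
rewrite exprS IHk -mulmxE mulmx_diag; congr diag_mx.
by apply/rowP => j; rewrite !mxE exprS.
Qed.

(** Powers commute with the conjugation by [U], so each entry of a partial sum of the matrix
    exponential is a combination, with coefficients independent of the order, of the scalar partial
    sums converging to [expi (x k)]. *)
Lemma expmx_diag (x : 'I_N -> R) :
  expmx (U *m diag_mx (\row_j (x j) *i) *m U^t*) =
  U *m diag_mx (\row_j expi (x j)) *m U^t*.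
Proof.
apply/matrixP => i j; rewrite [LHS]mxE; apply: ccvg_cReIm_lim.
rewrite mulmx_diag3E [X in ccvg _ X](_ : _ = fun m =>
    \sum_k U i k * U^t* k j * (\sum_(l < m) (l`!%:R)^-1 * ((x k) *i) ^+ l)).
  by apply: ccvg_sum => k; apply: ccvgZ; rewrite mxE; exact: ccvg_expi.
apply/funext => m; rewrite summxE.
under eq_bigr do
  rewrite mxE exprmx_conj exprmx_diag mulmx_diag3E mulr_sumr.
rewrite exchange_big; apply: eq_bigr => k _.
by rewrite mulr_sumr; apply: eq_bigr => l _; rewrite !mxE; ring.
Qed.

(** Unitary covariance of the Lindbladian. The jump term needs only associativity; in the other two
    terms [U^t* *m U] cancels between the two coupling factors on the left side, and [U *m U^t*] at
    the outer end on the right side. *)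
Lemma lindblad_conj K rho : lindblad (U *m K *m U^t*) rho =
  U *m lindblad K (U^t* *m rho *m U) *m U^t*.
Proof.
rewrite /lindblad !trmxCM trmxCK mulmxBr mulmxBl -scalemxAr -scalemxAl.
rewrite mulmxDr mulmxDl; congr (_ - _ *: (_ + _)); rewrite !mulmxA.
- by [].
- rewrite -[in LHS](mulmxA _ (U^t*) U) UU mulmx1.
  by rewrite -[in RHS](mulmxA _ U (U^t*)) UU' mulmx1.
- by rewrite UU' mul1mx -[in LHS](mulmxA _ (U^t*) U) UU mulmx1.
Qed.

End Unitary.

(** * Integrability of the Fourier integrands *)

Section Fourier.
Context (R : realType).
Implicit Types (f : R -> R[i]) (w : R).

Lemma cLintegralE f : cLintegral f = cintegral (@lebesgue_measure R) f.
Proof. by []. Qed.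

Lemma integrable_mul_bounded (u h : R -> R) :
  (@lebesgue_measure R).-integrable setT (EFin \o u) ->
  measurable_fun setT h -> (forall s, `|h s| <= 1) ->
  (@lebesgue_measure R).-integrable setT (EFin \o (fun s => u s * h s)).
Proof.
move=> hu mh h1; apply: (le_integrable _ _ _ hu) => //.
  apply/measurable_EFinP; apply: measurable_funM => //.
  by apply/measurable_EFinP; case/integrableP: hu.
by move=> s _ /=; rewrite lee_fin normrM ler_piMr.
Qed.

(** The real and imaginary parts of the integrand combine those of [f], multiplied by a sine or
    cosine bounded by 1, so they are dominated by integrable functions. *)
Lemma cintegrable_expi f w : cLintegrable f ->
  cintegrable (@lebesgue_measure R) (fun s => f s * expi (w * s)).
Proof.
move=> [fr fi].
have mw : measurable_fun setT (fun s : R => w * s) by exact: measurable_funM.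
have mc : measurable_fun setT (fun s => cos (w * s)).
  apply: measurableT_comp => //; apply: continuous_measurable_fun.
  exact: continuous_cos.
have ms : measurable_fun setT (fun s => sin (w * s)).
  apply: measurableT_comp => //; apply: continuous_measurable_fun.
  exact: continuous_sin.
have c1 s : `|cos (w * s)| <= 1 by rewrite ler_norml cos_geN1 cos_le1.
have s1 s : `|sin (w * s)| <= 1 by rewrite ler_norml sin_geN1 sin_le1.
split.
  have := integrable_linear 1 (-1) (integrable_mul_bounded fr mc c1)
    (integrable_mul_bounded fi ms s1).
  by congr (_.-integrable _ _); apply/funext => s /=; rewrite ReM /=; congr EFin; ring.
have := integrable_linear 1 1 (integrable_mul_bounded fr ms s1)
    (integrable_mul_bounded fi mc c1).
by congr (_.-integrable _ _); apply/funext => s /=; rewrite ImM /=; congr EFin; ring.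
Qed.

End Fourier.

(** * The coupling operator in the eigenbasis of the Hamiltonian *)

Section Coupling.
Context (R : realType) (N : nat).
Variables (U H : 'M[R[i]]_N) (lam : 'I_N -> R).
Hypothesis UU : U^t* *m U = 1%:M.
Hypothesis HE : H = U *m diag_mx (\row_j (lam j)%:C) *m U^t*.

Lemma expmx_evolution s :
  expmx ((s *i) *: H) = U *m diag_mx (\row_j expi (s * lam j)) *m U^t*.
Proof.
rewrite -(expmx_diag UU (fun j => s * lam j)); congr expmx.
rewrite HE scalemxAl scalemxAr; congr (_ *m _ *m _).
apply/matrixP => i j; rewrite !mxE.
case: eqP => _; last by rewrite !mulr0n mulr0.
rewrite !mulr1n; apply/eqP; rewrite eq_complex /=.
by apply/andP; split; apply/eqP; ring.
Qed.

(** In the eigenbasis the evolution multiplies the entry [(k, l)] of [A] by the phase of frequency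
    [lam k - lam l]; integrating that phase against [f] yields the Fourier transform at this
    frequency. *)
Lemma couplingE (f : R -> R[i]) A : cLintegrable f ->
  coupling f H A = U *m (\matrix_(k, l)
    (fourier f (lam k - lam l) * (U^t* *m A *m U) k l)) *m U^t*.
Proof.
move=> fint; apply/matrixP => i j; rewrite [LHS]mxE mulmx3E cLintegralE.
have assocE (V D E : 'M[R[i]]_N) : U *m D *m V *m A *m (U *m E *m V) =
    U *m (D *m (V *m A *m U) *m E) *m V by rewrite !mulmxA.
(* The adjoint is generalized to an opaque [V], so that later uses of [mxE] do not expand its
   entries. *)
have := expmx_evolution; move: (U^t*) => V evol.
transitivity (cintegral (@lebesgue_measure R) (fun s => \sum_(x : 'I_N * 'I_N)
  (U i x.1 * (V *m A *m U) x.1 x.2 * V x.2 j) *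
  (f s * expi ((lam x.1 - lam x.2) * s)))).
  apply: eq_cintegral => s.
  have -> : - (s *i) = (- s) *i :> R[i].
    by apply/eqP; rewrite eq_complex /= oppr0 !eqxx.
  rewrite !evol mxE.
  rewrite assocE.
  rewrite mulmx3E mulr_sumr; apply: eq_bigr => -[k l] _ /=.
  rewrite mul_mx_diag mxE mul_diag_mx mxE !mxE.
  have -> : (lam k - lam l) * s = s * lam k + (- s * lam l) by ring.
  rewrite expiD; ring.
rewrite cintegral_sum => [|x _]; last first.
  by apply: cintegrableZ; exact: cintegrable_expi.
apply: eq_bigr => -[k l] _ /=.
rewrite cintegralZ; last exact: cintegrable_expi.
by rewrite [in RHS]mxE /fourier cLintegralE; ring.
Qed.

End Coupling.

(** * Finite second moments and integrability of products *)

Lemma normr_mulD_le (R : realType) (x y u v : R) :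
  `|x * u + y * v| <= `|x ^+ 2 + y ^+ 2 + (u ^+ 2 + v ^+ 2)|.
Proof.
rewrite [leRHS]ger0_norm ?addr_ge0 ?sqr_ge0// ler_norml.
(* These squares encode that [2 * x * u] and [2 * y * v] are bounded in absolute value by the
   corresponding sums of squares. *)
have := (sqr_ge0 (x + u), sqr_ge0 (x - u), sqr_ge0 (y + v), sqr_ge0 (y - v)).
have := (sqr_ge0 x, sqr_ge0 y, sqr_ge0 u, sqr_ge0 v).
rewrite !expr2 => -[[[? ?] ?] ?] [[[? ?] ?] ?].
by apply/andP; split; nra.
Qed.

Section SquareIntegrable.
Context (R : realType) d (T : measurableType d) (P : probability T R).
Implicit Types X Y : T -> R[i].

Definition cmeasurable X : Prop :=
  measurable_fun setT (fun a => complex.Re (X a)) /\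
  measurable_fun setT (fun a => complex.Im (X a)).

Lemma cmeasurable_cst (c : R[i]) : cmeasurable (fun=> c).
Proof. by split; exact: measurable_cst. Qed.

Lemma cmeasurableD X Y :
  cmeasurable X -> cmeasurable Y -> cmeasurable (fun a => X a + Y a).
Proof.
move=> [Xr Xi] [Yr Yi]; split.
  by under eq_fun do rewrite ReD; exact: measurable_funD.
by under eq_fun do rewrite ImD; exact: measurable_funD.
Qed.

Lemma cmeasurableM X Y :
  cmeasurable X -> cmeasurable Y -> cmeasurable (fun a => X a * Y a).
Proof.
move=> [Xr Xi] [Yr Yi]; split.
  under eq_fun do rewrite ReM mulNr.
  by apply: measurable_funB; exact: measurable_funM.
under eq_fun do rewrite ImM.
by apply: measurable_funD; exact: measurable_funM.
Qed.

Lemma cmeasurable_sum (I : Type) (r : seq I) (F : I -> T -> R[i]) :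
  (forall i, cmeasurable (F i)) -> cmeasurable (fun a => \sum_(i <- r) F i a).
Proof.
move=> hF; elim: r => [|i r IHr].
  rewrite [X in cmeasurable X](_ : _ = fun=> 0); first exact: cmeasurable_cst.
  by apply/funext => x; rewrite big_nil.
rewrite [X in cmeasurable X](_ : _ = fun x =>
    F i x + \sum_(j <- r) F j x); first exact: cmeasurableD.
by apply/funext => x; rewrite big_cons.
Qed.

(** The squared modulus, kept real-valued so that it can serve as a dominating function for real
    integrability. *)
Definition sqn X a := complex.Re (X a) ^+ 2 + complex.Im (X a) ^+ 2.

Lemma mulcJ_sqn X a : X a * Num.conj (X a) = (sqn X a)%:C.
Proof.
rewrite /sqn; case: (X a) => x y; apply/eqP; rewrite eq_complex /=.
by apply/andP; split; apply/eqP; ring.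
Qed.

(* [fine] sends +oo to 0, so a nonzero second moment is a finite one. *)
Lemma integrable_sqn X : cmeasurable X ->
  cexpectation P (fun a => X a * Num.conj (X a)) != 0 ->
  P.-integrable setT (EFin \o sqn X).
Proof.
move=> [mr mi]; rewrite cexpectationE => X0.
have ms : measurable_fun setT (sqn X).
  by apply: measurable_funD; exact: measurable_funX.
have n0 a : 0 <= sqn X a by rewrite addr_ge0 ?sqr_ge0.
apply/integrableP; split; first exact/measurable_EFinP.
under eq_integral do rewrite /= ger0_norm//.
rewrite ltey; apply: contra_neq X0 => Xoo.
rewrite /cintegral /Rintegral; under eq_integral do rewrite mulcJ_sqn.
under [X in _ +i* fine X]eq_integral do rewrite mulcJ_sqn.
by rewrite Xoo integral0.
Qed.

(** Both parts of the product are dominated pointwise by the sum of the two squared moduli. *)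
Lemma cintegrable_conjM X Y : cmeasurable X -> cmeasurable Y ->
  P.-integrable setT (EFin \o sqn X) -> P.-integrable setT (EFin \o sqn Y) ->
  cintegrable P (fun a => X a * Num.conj (Y a)).
Proof.
move=> [Xr Xi] [Yr Yi] iX iY.
have iXY := integrable_linear 1 1 iX iY.
have ReE a : complex.Re (X a * Num.conj (Y a)) =
  complex.Re (X a) * complex.Re (Y a) + complex.Im (X a) * complex.Im (Y a).
  by rewrite ReM; case: (Y a) => u v /=; ring.
have ImE a : complex.Im (X a * Num.conj (Y a)) =
  complex.Im (X a) * complex.Re (Y a) - complex.Re (X a) * complex.Im (Y a).
  by rewrite ImM; case: (Y a) => u v /=; ring.
split; apply: (le_integrable _ _ _ iXY) => //.
- apply/measurable_EFinP; under eq_fun do rewrite ReE.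
  by apply: measurable_funD; exact: measurable_funM.
- move=> a _ /=; rewrite lee_fin ReE /sqn !mul1r.
  exact: normr_mulD_le.
- apply/measurable_EFinP; under eq_fun do rewrite ImE.
  by apply: measurable_funB; exact: measurable_funM.
- move=> a _ /=; rewrite lee_fin ImE /sqn !mul1r.
  (* The imaginary part is the inner product of [Y] with the rotated vector [(Im X, - Re X)], which
     has the same squared norm as [X]. *)
  have := normr_mulD_le (complex.Im (X a)) (- complex.Re (X a))
    (complex.Re (Y a)) (complex.Im (Y a)).
  by rewrite sqrrN mulNr (addrC (complex.Im (X a) ^+ 2)).
Qed.

End SquareIntegrable.

(** * Linearity of the entrywise expectation of random matrices *)

Section MatrixExpectation.
Context (R : realType) d (T : measurableType d) (P : probability T R) (N : nat).
Implicit Types (X Y : T -> 'M[R[i]]_N) (B C : 'M[R[i]]_N).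

Definition mx_integrable X := forall i j, cintegrable P (fun a => X a i j).

Lemma eq_mx_expectation X Y : X =1 Y -> mx_expectation P X = mx_expectation P Y.
Proof. by move=> /funext ->. Qed.

Lemma mx_integrableD X Y : mx_integrable X -> mx_integrable Y ->
  mx_integrable (fun a => X a + Y a).
Proof.
move=> hX hY i j; under eq_fun do rewrite mxE.
exact: cintegrableD.
Qed.

Lemma mx_integrableZ c X : mx_integrable X -> mx_integrable (fun a => c *: X a).
Proof.
move=> hX i j; under eq_fun do rewrite mxE.
exact: cintegrableZ.
Qed.

Let mulmxE3 X B C i j a : (B *m X a *m C) i j =
  \sum_(x : 'I_N * 'I_N) (B i x.1 * C x.2 j) * X a x.1 x.2.
Proof. by rewrite mulmx3E; apply: eq_bigr => x _; rewrite mulrAC. Qed.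

Lemma mx_integrableM B C X :
  mx_integrable X -> mx_integrable (fun a => B *m X a *m C).
Proof.
move=> hX i j; under eq_fun do rewrite mulmxE3.
by apply: cintegrable_sum => x _; exact: cintegrableZ.
Qed.

Lemma mx_expectationD X Y : mx_integrable X -> mx_integrable Y ->
  mx_expectation P (fun a => X a + Y a) =
  mx_expectation P X + mx_expectation P Y.
Proof.
move=> hX hY; apply/matrixP => i j; rewrite !mxE !cexpectationE -cintegralD//.
by apply: eq_cintegral => a; rewrite mxE.
Qed.

Lemma mx_expectationZ c X : mx_integrable X ->
  mx_expectation P (fun a => c *: X a) = c *: mx_expectation P X.
Proof.
move=> hX; apply/matrixP => i j; rewrite !mxE !cexpectationE -cintegralZ//.
by apply: eq_cintegral => a; rewrite mxE.
Qed.

Lemma mx_expectationM B C X : mx_integrable X ->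
  mx_expectation P (fun a => B *m X a *m C) = B *m mx_expectation P X *m C.
Proof.
move=> hX; apply/matrixP => i j; rewrite mxE cexpectationE mulmx3E.
under eq_cintegral do rewrite mulmxE3.
rewrite cintegral_sum => [|x _]; last exact: cintegrableZ.
apply: eq_bigr => x _.
by rewrite cintegralZ// mxE cexpectationE mulrAC.
Qed.

Lemma mx_integrable_lindblad (K : T -> 'M[R[i]]_N) rho :
  mx_integrable (fun a => K a *m rho *m (K a)^t*) ->
  mx_integrable (fun a => (K a)^t* *m K a) ->
  mx_integrable (fun a => lindblad (K a) rho).
Proof.
move=> h1 h2; rewrite /lindblad.
(* Inserted identity matrices give both anticommutator terms the shape [B *m X a *m C] with constant
   outer factors; the subtraction becomes a scaling by [- 2^-1]. *)
rewrite [X in mx_integrable X](_ : _ = fun a => K a *m rho *m (K a)^t* +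
  - 2^-1 *: (1%:M *m ((K a)^t* *m K a) *m rho + rho *m ((K a)^t* *m K a) *m 1%:M)).
  apply: mx_integrableD => //; apply: mx_integrableZ.
  by apply: mx_integrableD; exact: mx_integrableM.
by apply/funext => a; rewrite mul1mx mulmx1 scaleNr.
Qed.

Lemma mx_expectation_lindblad (K : T -> 'M[R[i]]_N) rho :
  mx_integrable (fun a => K a *m rho *m (K a)^t*) ->
  mx_integrable (fun a => (K a)^t* *m K a) ->
  mx_expectation P (fun a => lindblad (K a) rho) =
  mx_expectation P (fun a => K a *m rho *m (K a)^t*) - 2^-1 *:
    (mx_expectation P (fun a => (K a)^t* *m K a) *m rho +
     rho *m mx_expectation P (fun a => (K a)^t* *m K a)).
Proof.
move=> h1 h2; rewrite (@eq_mx_expectation _ (fun a => K a *m rho *m (K a)^t* +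
  - 2^-1 *: (1%:M *m ((K a)^t* *m K a) *m rho + rho *m ((K a)^t* *m K a) *m 1%:M))).
  rewrite mx_expectationD// ?mx_expectationZ ?mx_expectationD ?mx_expectationM//;
    try do ?[exact: mx_integrableM|apply: mx_integrableD|apply: mx_integrableZ].
  by rewrite mul1mx mulmx1 scaleNr.
by move=> a; rewrite mul1mx mulmx1 scaleNr.
Qed.

End MatrixExpectation.

(** * The averaged generator under the covariance assumption *)

Lemma conj_real (R : realType) (x : R) : Num.conj x%:C = x%:C :> R[i].
Proof. exact: conjc_real. Qed.

Section WhiteCoupling.
Context (R : realType) d (T : measurableType d) (P : probability T R) (N : nat).
Variables (X : T -> 'M[R[i]]_N) (c : R[i]) (g : 'I_N -> 'I_N -> R).
Hypothesis X_integrable : forall i j k l,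
  cintegrable P (fun a => X a i j * Num.conj (X a l k)).
Hypothesis X_cov : forall i j k l,
  cexpectation P (fun a => X a i j * Num.conj (X a l k)) =
  c * (i == l)%:R * (j == k)%:R.

(** The coupling operator in eigenbasis coordinates: [g k l] will be the square root of
    [gamma (lam k - lam l)], and [X a] the random operator in that basis. *)
Let K a : 'M[R[i]]_N := \matrix_(k, l) ((g k l)%:C * X a k l).

Let sandwichE rho i j a : (K a *m rho *m (K a)^t*) i j =
  \sum_(x : 'I_N * 'I_N) ((g i x.1)%:C * (g j x.2)%:C * rho x.1 x.2) *
     (X a i x.1 * Num.conj (X a j x.2)).
Proof.
rewrite mulmx3E; apply: eq_bigr => x _.
by rewrite !mxE rmorphM /= conj_real; ring.
Qed.

Let squareE i j a : ((K a)^t* *m K a) i j =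
  \sum_m ((g m i)%:C * (g m j)%:C) * (X a m j * Num.conj (X a m i)).
Proof.
rewrite mxE; apply: eq_bigr => m _.
by rewrite !mxE rmorphM /= conj_real; ring.
Qed.

Lemma mx_integrable_sandwich rho :
  mx_integrable P (fun a => K a *m rho *m (K a)^t*).
Proof.
move=> i j; under eq_fun do rewrite sandwichE.
by apply: cintegrable_sum => x _; exact: cintegrableZ.
Qed.

Lemma mx_integrable_square : mx_integrable P (fun a => (K a)^t* *m K a).
Proof.
move=> i j; under eq_fun do rewrite squareE.
by apply: cintegrable_sum => x _; exact: cintegrableZ.
Qed.

Lemma mx_expectation_sandwich rho i j :
  mx_expectation P (fun a => K a *m rho *m (K a)^t*) i j =
  c * (i == j)%:R * \sum_k (g i k ^+ 2)%:C * rho k k.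
Proof.
rewrite mxE cexpectationE; under eq_cintegral do rewrite sandwichE.
rewrite cintegral_sum => [|x _]; last exact: cintegrableZ.
under eq_bigr do rewrite cintegralZ// -cexpectationE X_cov.
rewrite -(pair_bigA _ (fun k l => (g i k)%:C * (g j l)%:C * rho k l *
  (c * (i == j)%:R * (k == l)%:R))) mulr_sumr; apply: eq_bigr => k _ /=.
rewrite (bigD1 k)//= big1 => [|l /negbTE]; last first.
  by rewrite eq_sym => ->; rewrite !mulr0.
rewrite eqxx addr0 rmorphXn /=.
(* For [i = j] the weights [g i k] and [g j k] combine into a square; otherwise both sides
   vanish. *)
by case: eqP => [->|_] /=; ring.
Qed.

Lemma mx_expectation_square :
  mx_expectation P (fun a => (K a)^t* *m K a) =
  diag_mx (\row_j (c * \sum_m (g m j ^+ 2)%:C)).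
Proof.
apply/matrixP => i j.
rewrite mxE cexpectationE; under eq_cintegral do rewrite squareE.
rewrite cintegral_sum => [|x _]; last exact: cintegrableZ.
under eq_bigr do rewrite cintegralZ// -cexpectationE X_cov.
rewrite !mxE -[RHS]mulr_natr mulr_sumr mulr_suml; apply: eq_bigr => m _.
rewrite eqxx rmorphXn /= eq_sym.
by case: eqP => [->|_] /=; ring.
Qed.

(** The averaged [(K a)^t* *m K a] is diagonal, so multiplying [rho] by it on the left and on the
    right scales the entry [(i, j)] by the column sums of [g] squared at [i] and at [j], here merged
    into one sum. *)
Lemma mx_expectation_lindblad_coupling rho i j :
  mx_expectation P (fun a => lindblad (K a) rho) i j =
  c * (i == j)%:R * (\sum_k (g i k ^+ 2)%:C * rho k k) -
  c / 2 * (\sum_k (g k i ^+ 2 + g k j ^+ 2)%:C) * rho i j.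
Proof.
rewrite mx_expectation_lindblad; [|exact: mx_integrable_sandwich
  |exact: mx_integrable_square].
rewrite [LHS]mxE mx_expectation_sandwich; congr (_ + _).
rewrite mx_expectation_square mul_diag_mx mul_mx_diag !mxE.
under [in RHS]eq_bigr do rewrite rmorphD.
by rewrite big_split /=; ring.
Qed.

End WhiteCoupling.

(** * Passage from standard coordinates to the eigenbasis *)

Lemma has_derivative_at_mulmx3 (R : realType) N (B C : 'M[R[i]]_N)
    (z : R -> 'M[R[i]]_N) t (l : 'M[R[i]]_N) :
  (forall i j, has_derivative_at (fun s => z s i j) t (l i j)) ->
  forall i j,
    has_derivative_at (fun s => (B *m z s *m C) i j) t ((B *m l *m C) i j).
Proof.
move=> hz i j.
(* Each entry of the product is a constant-coefficient combination of the standard entries, for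
   which the Lindblad equation is stated. *)
have E (M : 'M[R[i]]_N) : (B *m M *m C) i j =
    \sum_(x : 'I_N * 'I_N) (B i x.1 * C x.2 j) * M x.1 x.2.
  by rewrite mulmx3E; apply: eq_bigr => x _; rewrite mulrAC.
rewrite E [X in has_derivative_at X](_ : _ = fun s =>
    \sum_(x : 'I_N * 'I_N) (B i x.1 * C x.2 j) * z s x.1 x.2).
  exact: has_derivative_at_linear.
by apply/funext => s; rewrite E.
Qed.

Section Eigenbasis.
Context (R : realType) (N : nat).
Variables (H : 'M[R[i]]_N) (lam : 'I_N -> R) (psi : 'I_N -> 'cV[R[i]]_N).
Hypothesis H_eig : orthonormal_eigenbasis H lam psi.

Definition basis_mx : 'M[R[i]]_N := \matrix_(k, j) psi j k 0.

Lemma braketE M i j :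
  braket (psi i) M (psi j) = (basis_mx^t* *m M *m basis_mx) i j.
Proof.
rewrite /braket !mulmx3E; apply: eq_bigr => x _.
by rewrite !mxE.
Qed.

Lemma basis_mx_unitary : basis_mx^t* *m basis_mx = 1%:M.
Proof.
apply/matrixP => i j; rewrite [RHS]mxE -H_eig.1 !mxE.
by apply: eq_bigr => k _; rewrite !mxE.
Qed.

Lemma eigenbasis_decomp :
  H = basis_mx *m diag_mx (\row_j (lam j)%:C) *m basis_mx^t*.
Proof.
have HU : H *m basis_mx = basis_mx *m diag_mx (\row_j (lam j)%:C).
  apply/matrixP => k j; rewrite mul_mx_diag !mxE mulrC.
  have := congr1 (fun v : 'cV_N => v k 0) (H_eig.2 j); rewrite !mxE => <-.
  by apply: eq_bigr => l _; rewrite mxE.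
by rewrite -HU -mulmxA (mulmx1C basis_mx_unitary) mulmx1.
Qed.

Lemma eigenbasis_spec i : H \is hermsymmx -> spec H (lam i).
Proof.
move=> /is_hermitianmxP; rewrite expr0 scale1r => Hh.
(* [eigenvalue] refers to row eigenvectors, so the witness is the adjoint of [psi i]; this works
   because [H] is Hermitian and [lam i] is real. *)
apply/eigenvalueP; exists ((psi i)^t*).
  rewrite {1}Hh -map_mxM -trmx_mul H_eig.2.
  by apply/rowP => j; rewrite !mxE rmorphM /= conj_real.
apply: contra_neq (oner_neq0 R[i]) => psi0.
by have := H_eig.1 i i; rewrite psi0 mul0mx mxE eqxx.
Qed.

End Eigenbasis.

(** * The Pauli master equation and the decay of the off-diagonal entries *)

Lemma pauli_rhsE (R : realType) N (c : R[i]) (gam : 'I_N -> 'I_N -> R)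
    (p : 'I_N -> R[i]) i :
  c * true%:R * (\sum_k (gam i k)%:C * p k) -
    c / 2 * (\sum_k (gam k i + gam k i)%:C) * p i =
  c * \sum_(k | k != i) ((gam i k)%:C * p k - (gam k i)%:C * p i).
Proof.
have -> : \sum_(k | k != i) ((gam i k)%:C * p k - (gam k i)%:C * p i) =
    \sum_k ((gam i k)%:C * p k - (gam k i)%:C * p i).
  (* The gain and loss terms at [k = i] cancel, so that index may be restored to the sum. *)
  by rewrite [RHS](bigD1 i)//= subrr add0r.
have -> : \sum_k (gam k i + gam k i)%:C = 2 * \sum_k (gam k i)%:C.
  by rewrite mulr_sumr; apply: eq_bigr => k _; rewrite rmorphD /=; ring.
by rewrite sumrB -mulr_suml /=; field.
Qed.

Theorem theorem12 (R : realType)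
  (xi : nat -> R)
  (xi_gt0 : forall n, 0 < xi n)
  (xi_Theta : xi \is 'Theta_\oo (fun n => (Num.sqrt (2 ^ n)%:R)^-1 : R))
  (n : nat)
  (H : 'M[R[i]]_(2 ^ n)) (H_herm : H \is hermsymmx)
  (lam : 'I_(2 ^ n) -> R) (psi : 'I_(2 ^ n) -> 'cV[R[i]]_(2 ^ n))
  (H_eig : orthonormal_eigenbasis H lam psi)
  (beta : R) (beta_gt0 : 0 < beta)
  (gamma : R -> R) (gamma_ge0 : forall w, 0 <= gamma w)
  (gamma_kms : forall w, gamma w = expR (- (beta * w)) * gamma (- w))
  (f : R -> R[i]) (f_int : cLintegrable f)
  (f_hat : forall w, bohr_frequencies H w ->
     fourier f w = (Num.sqrt (gamma w))%:C)
  (d : measure_display) (T : measurableType d) (P : probability T R)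
  (A : T -> 'M[R[i]]_(2 ^ n)) (A_herm : random_hermitian A)
  (A_cov : forall i j k l : 'I_(2 ^ n),
     cexpectation P (fun a =>
       braket (psi i) (A a) (psi j) * Num.conj (braket (psi l) (A a) (psi k)))
     = (xi n ^+ 2)%:C * (i == l)%:R * (j == k)%:R)
  (rho : R -> 'M[R[i]]_(2 ^ n))
  (rho_sol : averaged_lindblad_solution P (fun a => coupling f H (A a)) rho) :
  (forall (i : 'I_(2 ^ n)) (t : R), 0 <= t ->
     has_derivative_at (fun s => braket (psi i) (rho s) (psi i)) t
       ((xi n ^+ 2)%:C *
        \sum_(k < 2 ^ n | k != i)
          ((gamma (lam i - lam k))%:C * braket (psi k) (rho t) (psi k)
           - (gamma (lam k - lam i))%:C * braket (psi i) (rho t) (psi i)))) /\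
  (forall (i j : 'I_(2 ^ n)), i != j -> forall t : R, 0 <= t ->
     has_derivative_at (fun s => braket (psi i) (rho s) (psi j)) t
       (- ((xi n ^+ 2 / 2)%:C *
           \sum_(k < 2 ^ n) (gamma (lam k - lam i) + gamma (lam k - lam j))%:C)
        * braket (psi i) (rho t) (psi j))).
Proof.
pose U := basis_mx psi; pose X a := U^t* *m A a *m U.
pose g k l := Num.sqrt (gamma (lam k - lam l)).
have UU : U^t* *m U = 1%:M by exact: basis_mx_unitary H_eig.
have g2 k l : g k l ^+ 2 = gamma (lam k - lam l) by rewrite sqr_sqrtr.
have X_meas i j : cmeasurable (fun a => X a i j).
  rewrite [X in cmeasurable X](_ : _ = fun a =>
      \sum_(x : 'I_(2 ^ n) * 'I_(2 ^ n)) U^t* i x.1 * A a x.1 x.2 * U x.2 j).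
    apply: cmeasurable_sum => x; apply: cmeasurableM; last exact: cmeasurable_cst.
    by apply: cmeasurableM; [exact: cmeasurable_cst|exact: A_herm.1].
  by apply/funext => a; rewrite mulmx3E.
have X_cov i j k l : cexpectation P (fun a => X a i j * Num.conj (X a l k)) =
    (xi n ^+ 2)%:C * (i == l)%:R * (j == k)%:R.
  rewrite -A_cov; congr (cexpectation P _).
  by apply/funext => a; rewrite !braketE.
have X_sq i j := integrable_sqn (P := P) (X_meas i j).
have X_int i j k l : cintegrable P (fun a => X a i j * Num.conj (X a l k)).
  (* Positivity of [xi n] makes the second moment of every entry nonzero, hence finite. *)
  have c0 : (xi n ^+ 2)%:C != 0.
    by rewrite eq_complex /= eqxx andbT expf_neq0// gt_eqF.
  by apply: cintegrable_conjM => //; apply: X_sq; rewrite X_cov !eqxx !mulr1.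
pose K a : 'M[R[i]]_(2 ^ n) := \matrix_(k, l) ((g k l)%:C * X a k l).
have coupE a : coupling f H (A a) = U *m K a *m U^t*.
  rewrite (couplingE UU (eigenbasis_decomp H_eig) _ f_int); congr (_ *m _ *m _).
  apply/matrixP => k l; rewrite !mxE f_hat//.
  (* The frequency [lam k - lam l] is a Bohr frequency, which is where the value of the Fourier
     transform of [f] is prescribed. *)
  exists (lam k); first exact: (eigenbasis_spec H_eig).
  by exists (lam l); first exact: (eigenbasis_spec H_eig).
(* By unitary covariance the conjugation moves inside the Lindbladian, and the constant outer
   factors leave the expectation and cancel. *)
have lindbladE r : U^t* *m mx_expectation P
      (fun a => lindblad (coupling f H (A a)) r) *m U =
    mx_expectation P (fun a => lindblad (K a) (U^t* *m r *m U)).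
  transitivity (U^t* *m mx_expectation P (fun a =>
      U *m lindblad (K a) (U^t* *m r *m U) *m U^t*) *m U).
    congr (_ *m _ *m _); apply: eq_mx_expectation => a.
    by rewrite coupE lindblad_conj.
  rewrite mx_expectationM; last first.
    apply: mx_integrable_lindblad.
      exact: mx_integrable_sandwich.
    exact: mx_integrable_square.
  by rewrite !mulmxA UU mul1mx -mulmxA UU mulmx1.
(* One equation covers all entries: at [i = j] it is the Pauli equation before rearrangement, and
   for [i != j] the Kronecker delta removes the gain term, leaving pure decay. *)
have dE t i j : 0 <= t ->
    has_derivative_at (fun s => braket (psi i) (rho s) (psi j)) t
    ((xi n ^+ 2)%:C * (i == j)%:R *
      (\sum_k (gamma (lam i - lam k))%:C * braket (psi k) (rho t) (psi k)) -
     (xi n ^+ 2)%:C / 2 *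
      (\sum_k (gamma (lam k - lam i) + gamma (lam k - lam j))%:C) *
      braket (psi i) (rho t) (psi j)).
  move=> t0.
  have := has_derivative_at_mulmx3 (U^t*) U (rho_sol.2 t t0) i j.
  rewrite lindbladE (mx_expectation_lindblad_coupling g X_int X_cov).
  rewrite [X in has_derivative_at X](_ : _ = fun s =>
    braket (psi i) (rho s) (psi j)); last first.
    by apply/funext => s; rewrite braketE.
  rewrite braketE -/U.
  under eq_bigr do rewrite g2 -braketE.
  by under [X in _ - _ * X * _]eq_bigr do rewrite !g2.
split=> [i t t0|i j ij t t0].
  have := dE t i i t0; congr has_derivative_at.
  rewrite eqxx.
  exact: (pauli_rhsE _ (fun k l => gamma (lam k - lam l))
    (fun k => braket (psi k) (rho t) (psi k))).
have := dE t i j t0; congr has_derivative_at.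
rewrite (negbTE ij) mulr0 mul0r add0r mulNr.
by rewrite [(_ / _)%:C]rmorphM fmorphV rmorph_nat.
Qed.
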